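(* Let $q$ be a prime power and let $n \ge 6$ be an integer. We have \begin{align*} w_2(q,n,3) &= \tfrac{1}{72}q^4n^6 - \tfrac{1}{12}q^4n^5 + \tfrac{1}{18}q^4n^4 + \tfrac{1}{2}q^4n^3 - \tfrac{77}{72}q^4n^2 + \tfrac{7}{12}q^4n - \tfrac{1}{18}q^3n^6 \\ &\quad+ \tfrac{5}{12}q^3n^5 - \tfrac{49}{72}q^3n^4 - \tfrac{7}{6}q^3n^3 + \tfrac{269}{72}q^3n^2 - \tfrac{9}{4}q^3n + \tfrac{1}{12}q^2n^6 - \tfrac{3}{4}q^2n^5 \\ &\quad+ 2q^2n^4 - \tfrac{7}{12}q^2n^3 - \tfrac{43}{12}q^2n^2 + \tfrac{17}{6}q^2n - \tfrac{1}{18}qn^6 + \tfrac{7}{12}qn^5 - \tfrac{157}{72}qn^4 \\ &\quad+ \tfrac{19}{6}qn^3 - \tfrac{55}{72}qn^2 - \tfrac{3}{4}qn + \tfrac{1}{72}n^6 - \tfrac{1}{6}n^5 + \tfrac{29}{36}n^4 - \tfrac{23}{12}n^3 + \tfrac{157}{72}n^2 - \tfrac{11}{12}n. \end{align*}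
   Context: The Hamming weight of $v \in \mathbb{F}_q^n$ is the number of its nonzero coordinates. For integers $n,d\ge 1$, the higher-weight Dowling lattice $\mathcal{H}(q,n,d)$ is the set, ordered by inclusion, of all $\mathbb{F}_q$-linear subspaces of $\mathbb{F}_q^n$ that have a basis made of vectors of Hamming weight at most $d$, together with the zero space. It is a finite geometric lattice whose rank function is the $\mathbb{F}_q$-dimension. With $\mu$ the Möbius function of $\mathcal{H}(q,n,d)$, the $i$-th Whitney number (of the first kind) is $w_i(q,n,d)=\sum_{U \in \mathcal{H}(q,n,d),\ \dim U=i} \mu(\{0\},U)$. *)

(* Defs.v *)
From HB Require Import structures.
From mathcomp Require Import all_boot all_order all_algebra.

Set Implicit Arguments.
Unset Strict Implicit.
Unset Printing Implicit Defensive.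

Import Order.TTheory GRing.Theory Num.Theory.
Local Open Scope ring_scope.

Section Mobius.

Context {disp : Order.disp_t} {T : finPOrderType disp}.
Implicit Types x y z : T.

(* [k] is fuel: [#|T|] always suffices, see [mobiusE]. *)
Fixpoint mobius_rec (k : nat) x y : int :=
  if k is k'.+1 then
    if x == y then 1
    else if (x < y)%O then - \sum_(z | (x <= z < y)%O) mobius_rec k' x z
    else 0
  else 0.

Definition mobius x y : int := mobius_rec #|T| x y.

Lemma card_lt_lt z y :
  (z < y)%O -> (#|[set t : T | (t < z)%O]| < #|[set t : T | (t < y)%O]|)%N.
Proof.
move=> zy; apply/proper_card/properP; split.
  by apply/subsetP => t; rewrite !inE => tz; apply: lt_trans tz zy.
by exists z; rewrite !inE ?ltxx.
Qed.

Lemma mobius_rec_fuel k k' x y :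
    (#|[set t : T | (t < y)%O]| < k)%N -> (#|[set t : T | (t < y)%O]| < k')%N ->
  mobius_rec k x y = mobius_rec k' x y.
Proof.
elim: k k' y => [|k IHk] [|k'] y //= hk hk'.
case: eqP => // _; case: ifP => // _; congr (- _).
apply: eq_bigr => z /andP[_ zy].
by apply: IHk; apply: leq_trans (card_lt_lt zy) _.
Qed.

Lemma mobiusE x y :
  mobius x y = if x == y then 1
               else if (x < y)%O then - \sum_(z | (x <= z < y)%O) mobius x z
               else 0.
Proof.
have fuel z : (#|[set t : T | (t < z)%O]| < #|T|)%N.
  rewrite -cardsT; apply/proper_card/properP; split; first by apply/subsetP.
  by exists z; rewrite !inE ?ltxx.
by rewrite /mobius (@mobius_rec_fuel _ #|T|.+1) //= ltnS ltnW.
Qed.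

End Mobius.

HB.instance Definition _ (F : finFieldType) (vT : vectType F) :=
  Choice_isCountable.Build {vspace vT}
    (pcan_pickleK (can_pcan (@VectorInternalTheory.vs2mxK F vT))).
HB.instance Definition _ (F : finFieldType) (vT : vectType F) :=
  isFinite.Build {vspace vT}
    (pcan_enumP (can_pcan (@VectorInternalTheory.vs2mxK F vT))).

Section HigherWeightDowling.

Variables (F : finFieldType) (n d : nat).

Definition hamming_weight (v : 'rV[F]_n) : nat := #|[set i | v 0 i != 0]|.

Definition has_low_weight_basis (U : {vspace 'rV[F]_n}) : bool :=
  [exists X : (\dim U).-tuple 'rV[F]_n,
     basis_of U X && all (fun v => (hamming_weight v <= d)%N) X].

Record hwd : predArgType := HWD {
  hwd_space :> {vspace 'rV[F]_n};
  _ : (hwd_space == 0%VS) || has_low_weight_basis hwd_space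
}.

HB.instance Definition _ := [isSub for hwd_space].
HB.instance Definition _ := [Finite of hwd by <:].

Definition hwd_le (U V : hwd) : bool := (hwd_space U <= hwd_space V)%VS.

Fact hwd_le_refl : reflexive hwd_le.
Proof. by move=> U; apply: subvv. Qed.

Fact hwd_le_anti : antisymmetric hwd_le.
Proof. by move=> U V leUV; apply/val_inj/subv_anti. Qed.

Fact hwd_le_trans : transitive hwd_le.
Proof. by move=> V U W; apply: subv_trans. Qed.

Fact hwd_display : Order.disp_t. Proof. exact: Order.Disp tt tt. Qed.

HB.instance Definition _ := Order.Le_isPOrder.Build hwd_display hwd
  hwd_le_refl hwd_le_anti hwd_le_trans.

Fact hwd0_proof : (0%VS == 0%VS :> {vspace 'rV[F]_n}) || has_low_weight_basis 0%VS.
Proof. by rewrite eqxx. Qed.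

Definition hwd0 : hwd := HWD hwd0_proof.

Definition whitney1 (i : nat) : int :=
  \sum_(U : hwd | \dim U == i) mobius hwd0 U.

End HigherWeightDowling.

(* Main.v *)
Require Import Defs.
From mathcomp Require Import all_boot all_order all_algebra.
From mathcomp Require Import finfield zify ring lra.

Set Implicit Arguments.
Unset Strict Implicit.
Unset Printing Implicit Defensive.

Import Order.TTheory GRing.Theory Num.Theory.
Local Open Scope ring_scope.

(** The zero space and the lines of the lattice have Möbius values [1] and [-1], so
    a plane [U] containing [a] lines spanned by vectors of weight at most 3 has
    Möbius value [a - 1] ([mobius_plane]).  Planes outside the lattice are exactly
    those with [a <= 1] ([plane_hwd]), so the Whitney number is the sum over all
    planes of the truncated difference [a - 1] ([whitney1_planes]).

    The number [a] depends on the size [s] of the support of [U].  If [s <= 3]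
    every line of [U] is low, so [a = q + 1].  If [s <= 4] then the lines cut out
    of [U] by the vanishing of one coordinate of its support are low, and at least
    two of them are distinct, so [a >= 2] ([small_plane_lines]).  If [s >= 5] then
    [a <= 2] ([large_plane_lines]): the support of [U] is the union of the supports
    of any two independent vectors of [U], so three pairwise independent low
    vectors would cover each coordinate of the support at least twice, and
    [2 * s <= 9].

    In each case [a - 1] can therefore be read off from a number of ordered bases
    [(u, v)] of [U] singled out by the weights of [u] and [v] only.  This yields a
    rational [charge u v], a function of the supports of [u] and [v], whose sum
    over the ordered bases of [U] is twice their number [(q^2 - 1) * (q^2 - q)]
    times the truncated [a - 1] ([sum_charge_plane]).  Summing over all planes, the
    Whitney number becomes the sum of charges over all independent pairs, that is
    over all pairs ([sum_charge]) minus over the dependent ones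
    ([sum_charge_dependent]).  Both are sums over subsets of the coordinates, since
    a given set [A] is the support of [(q - 1) ^ #|A|] vectors, and counting
    subsets by cardinality turns them into explicit combinations of binomial
    coefficients in [n] and powers of [q - 1]. *)

(** * Sums over subsets and pairs of subsets of a finite set *)

Lemma sum_subsets_by_card (R : nmodType) (T : finType) (A : {set T})
    (m : nat) (f : nat -> R) :
  (forall j, (m <= j <= #|A|)%N -> f j = 0) ->
  \sum_(X : {set T} | X \subset A) f #|X| = \sum_(j < m) f j *+ 'C(#|A|, j).
Proof.
move=> f0.
transitivity (\sum_(X : {set T} | X \subset A)
                \sum_(j < m) if #|X| == j then f j else 0).
  apply: eq_bigr => X sXA; rewrite -big_mkcond /=.
  have [ltXm | leXm] := ltnP #|X| m; last first.
    rewrite f0 ?leXm ?subset_leq_card // big_pred0 // => j.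
    by apply/eqP => eqXj; move: (ltn_ord j); rewrite -eqXj ltnNge leXm.
  by rewrite (big_pred1 (Ordinal ltXm)) // => j; rewrite eq_sym.
rewrite exchange_big; apply: eq_bigr => j _.
rewrite -big_mkcondr /= -cards_draws -sumr_const.
by apply: eq_bigl => X; rewrite inE.
Qed.

(** A set [B] is determined by its traces on [A] and on the complement of [A],
    which are independent of each other. *)
Lemma sum_pairs_by_card (R : nmodType) (T : finType) (m : nat)
    (g : nat -> nat -> nat -> R) :
  (forall i j k, (j <= i)%N -> (m <= i)%N || (m <= k)%N -> g i j k = 0) ->
  \sum_(A : {set T}) \sum_(B : {set T}) g #|A| #|A :&: B| #|B :\: A| =
  \sum_(i < m) \sum_(j < i.+1) \sum_(k < m)
     g i j k *+ ('C(#|T|, i) * 'C(i, j) * 'C(#|T| - i, k)).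
Proof.
move=> g0.
pose h i := \sum_(j < i.+1) \sum_(k < m) g i j k *+ ('C(i, j) * 'C(#|T| - i, k)).
have inner (A : {set T}) :
    \sum_(B : {set T}) g #|A| #|A :&: B| #|B :\: A| = h #|A|.
  pose split (B : {set T}) := (A :&: B, B :\: A).
  pose glue (p : {set T} * {set T}) := p.1 :|: p.2.
  transitivity (\sum_(p : {set T} * {set T}
      | (p.1 \subset A) && (p.2 \subset ~: A)) g #|A| #|p.1| #|p.2|).
    rewrite (reindex_onto glue split) => [|B _] /=; last first.
      by rewrite /glue /= setIC setID.
    have splitK p : (split (glue p) == p) = (p.1 \subset A) && (p.2 \subset ~: A).
      case: p => X Y; rewrite /split /glue /=; apply/eqP/andP => [[eX eY]|[sX sY]].
        by rewrite -{1}eX -{2}eY subsetIl setDE subsetIr.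
      have dYA : A :&: Y = set0 by apply/disjoint_setI0; rewrite disjoint_sym disjoints_subset.
      rewrite setIUr (setIidPr sX) dYA setU0 setDUl.
      have -> : X :\: A = set0 by apply/eqP; rewrite setD_eq0.
      by rewrite set0U setDE (setIidPl sY).
    apply: eq_big => [p | p /eqP]; first exact: splitK.
    by case: p => X Y [-> ->].
  rewrite -(pair_big_dep (fun X : {set T} => X \subset A)
     (fun _ (Y : {set T}) => Y \subset ~: A) (fun X Y => g #|A| #|X| #|Y|)) /=.
  have cC : #|~: A| = (#|T| - #|A|)%N by rewrite -(cardsC A) addKn.
  pose f j := \sum_(k < m) g #|A| j k *+ 'C(#|T| - #|A|, k).
  transitivity (\sum_(X : {set T} | X \subset A) f #|X|).
    apply: eq_bigr => X sXA.
    rewrite (@sum_subsets_by_card _ _ _ m (g #|A| #|X|)) ?cC // => k /andP[lemk _].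
    by rewrite g0 ?lemk ?orbT ?subset_leq_card.
  rewrite (@sum_subsets_by_card _ _ _ #|A|.+1) => [|j /andP[ltAj lejA]].
    apply: eq_bigr => j _; rewrite -sumrMnl; apply: eq_bigr => k _.
    by rewrite -mulrnA mulnC.
  by rewrite ltnNge lejA in ltAj.
rewrite (eq_bigr (fun A : {set T} => h #|A|)) => [|A _]; last exact: inner.
rewrite (eq_bigl (fun A : {set T} => A \subset [set: T])) => [|A]; last first.
  by rewrite subsetT.
rewrite (@sum_subsets_by_card _ _ _ m) => [|i /andP[lemi _]].
  apply: eq_bigr => i _; rewrite cardsT -sumrMnl; apply: eq_bigr => j _.
  rewrite -sumrMnl; apply: eq_bigr => k _.
  by rewrite -mulrnA; congr (_ *+ _); lia.
rewrite /h big1 // => j _; rewrite big1 // => k _.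
by rewrite g0 ?mul0rn ?lemi // -ltnS.
Qed.

Lemma sum_const_pred (T : finType) (P : pred T) (c : rat) :
  \sum_(x | P x) c = c * #|[set x | P x]|%:R.
Proof. by rewrite mulr_natr -sumr_const; apply: eq_bigl => x; rewrite inE. Qed.

Lemma sum_bool_pred (T : finType) (P Q : pred T) :
  \sum_(x | P x) (Q x)%:R = #|[set x | P x && Q x]|%:R :> rat.
Proof.
rewrite -[RHS]mul1r -sum_const_pred big_mkcondr /=.
by apply: eq_bigr => x _; case: (Q x).
Qed.

Definition falling (y : rat) (k : nat) : rat := \prod_(l < k) (y - l%:R).

(** For [n < k] both sides vanish, the falling product having a zero factor, so
    the formula is polynomial in [n] without restriction. *)
Lemma natr_bin (n k : nat) : 'C(n, k)%:R = falling n%:R k / k`!%:R.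
Proof.
have k0 : k`!%:R != 0 :> rat by rewrite pnatr_eq0 -lt0n fact_gt0.
apply: (canRL (mulfK k0)); rewrite -natrM bin_ffact /falling {k0}.
elim: k => [|k IHk]; first by rewrite big_ord0 ffactn0.
rewrite big_ord_recr /= -IHk ffactnSr natrM.
have [lekn | ltnk] := leqP k n; first by rewrite natrB.
by rewrite ffact_small // !mul0r.
Qed.

(** * Supports *)

Section Dowling.

Variables (F : finFieldType) (n : nat).
Implicit Types (u v w : 'rV[F]_n) (U : {vspace 'rV[F]_n}) (A B : {set 'I_n}).

Definition supp v : {set 'I_n} := [set i | v 0 i != 0].

Lemma supp_scale (a : F) v : a != 0 -> supp (a *: v) = supp v.
Proof. by move=> a0; apply/setP => i; rewrite !inE mxE mulf_eq0 negb_or a0. Qed.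

Lemma supp_scale_sub (a : F) v : supp (a *: v) \subset supp v.
Proof.
by apply/subsetP => i; rewrite !inE mxE mulf_eq0 negb_or => /andP[].
Qed.

Lemma supp0 : supp 0 = set0.
Proof. by apply/setP => i; rewrite !inE mxE eqxx. Qed.

(** A vector with support [A] is a free choice of nonzero entries on [A]. *)
Lemma card_supp_eq A : #|[set v | supp v == A]| = (#|F|.-1 ^ #|A|)%N.
Proof.
have -> : #|F|.-1 = #|[pred x : F | x != 0]|.
  by rewrite -(cardC1 (0 : F)); apply: eq_card.
rewrite -(card_pffun_on (0 : F) (mem A) [pred x : F | x != 0]).
pose h (f : {ffun 'I_n -> F}) : 'rV[F]_n := \row_i f i.
have h_inj : injective h.
  by move=> f g /rowP e; apply/ffunP => i; move: (e i); rewrite !mxE.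
rewrite -(card_imset _ h_inj); apply: eq_card => v; rewrite inE.
apply/eqP/imsetP => [sv | [f /pffun_onP[/subsetP sf fA] ->]].
  exists [ffun i => v 0 i]; last by apply/rowP => i; rewrite mxE ffunE.
  apply/pffun_onP; split.
    by apply/subsetP => i; rewrite !inE ffunE -sv inE.
  by move=> _ /imageP[i Ai ->]; rewrite inE ffunE; rewrite -sv inE in Ai.
apply/setP => i; rewrite inE mxE; apply/idP/idP => [fi | Ai].
  by apply: sf; rewrite inE.
by have := fA (f i); rewrite inE; apply; apply/imageP; exists i.
Qed.

Lemma sum_by_supp (R : nmodType) (f : {set 'I_n} -> R) :
  \sum_v f (supp v) = \sum_A f A *+ (#|F|.-1 ^ #|A|).
Proof.
rewrite (partition_big supp xpredT) //; apply: eq_bigr => A _ /=.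
rewrite -card_supp_eq -sumr_const.
by apply: eq_big => [v | v /eqP->]; rewrite ?inE.
Qed.

(** * Planes, their ordered bases and their low-weight lines *)

Definition indep u v := (u != 0) && (v \notin <[u]>%VS).

Definition low d v := (v != 0) && (#|supp v| <= d)%N.

(** The atoms below [U]; [U] itself need not be in the lattice. *)
Definition lines d U := [set z : hwd F n d | (\dim z == 1)%N & (z <= U)%VS].

(** The coordinates that do not vanish identically on [U]. *)
Definition vsupp U : {set 'I_n} := [set i | [exists v in U, v 0 i != 0]].

Lemma indep_free u v : indep u v = free [:: v; u].
Proof. by rewrite free_cons span_seq1 seq1_free andbC. Qed.

Lemma indep_sym u v : indep u v = indep v u.
Proof. by rewrite !indep_free; apply/perm_free/permPl/(perm_catC [:: v] [:: u]). Qed.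

Lemma plane_spanned U u v :
  \dim U = 2 -> u \in U -> v \in U -> indep u v -> U = (<[u]> + <[v]>)%VS.
Proof.
move=> dU Uu Uv; rewrite indep_sym indep_free => uv_free.
apply/esym/eqP; rewrite eqEdim subv_add -!memvE Uu Uv dU.
by have := eqP uv_free; rewrite span_cons span_seq1 /= => ->.
Qed.

Lemma vsupp_sub U u : u \in U -> supp u \subset vsupp U.
Proof.
move=> Uu; apply/subsetP => i; rewrite !inE => ui.
by apply/existsP; exists u; rewrite Uu.
Qed.

(** If [u] and [v] both vanish at a coordinate, so do their combinations. *)
Lemma vsupp_basis U u v : \dim U = 2 -> u \in U -> v \in U -> indep u v ->
  supp u :|: supp v = vsupp U.
Proof.
move=> dU Uu Uv iuv; apply/eqP; rewrite eqEsubset subUset !vsupp_sub //=.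
apply/subsetP => i; rewrite !inE => /existsP[w /andP[]].
rewrite (plane_spanned dU Uu Uv iuv) => /memv_addP[_ /vlineP[a ->]].
move=> [_ /vlineP[b ->] ->]; rewrite !mxE; apply: contraR.
by rewrite negb_or !negbK => /andP[/eqP-> /eqP->]; rewrite !mulr0 addr0.
Qed.

Lemma card_nz U : #|[set u in U | u != 0]| = (#|F| ^ \dim U).-1.
Proof.
rewrite -(card_vspace U) (cardD1 0 (mem U)) mem0v add1n.
by apply: eq_card => u; rewrite !inE andbC.
Qed.

Lemma card_off_line U u : u \in U -> u != 0 ->
  #|[set v in U | v \notin <[u]>%VS]| = (#|F| ^ \dim U - #|F|)%N.
Proof.
move=> Uu u0.
have cu : #|<[u]>%VS| = #|F| by rewrite card_vspace dim_vline u0 expn1.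
rewrite -{2}cu -(card_vspace U) -(cardsE (mem U)) -(cardsID [set v in <[u]>%VS] [set v in U]).
have -> : [set v in U] :&: [set v in <[u]>%VS] = [set v in <[u]>%VS].
  apply/setIidPr/subsetP => v; rewrite !inE => /vlineP[a ->].
  exact: memvZ.
by rewrite (cardsE (mem <[u]>%VS)) addKn; apply: eq_card => v; rewrite !inE andbC.
Qed.

Lemma low_line_mem d u : low d u -> exists z : hwd F n d, hwd_space z = <[u]>%VS.
Proof.
case/andP=> u0 lu.
have hd : \dim <[u]> = 1%N by rewrite dim_vline u0.
have hu : has_low_weight_basis d <[u]>%VS.
  apply/existsP; rewrite hd; exists [tuple u].
  by rewrite /= lu basisEfree seq1_free u0 span_seq1 subvv hd.
by exists (HWD (introT orP (or_intror hu))).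
Qed.

Lemma hwd_basis d (z : hwd F n d) : exists X : seq 'rV[F]_n,
  [/\ basis_of z X, size X = \dim z & {in X, forall x, low d x}].
Proof.
case: z => U hU /=; case/orP: (hU) => [/eqP U0 | /existsP[X /andP[bX /allP lX]]].
  by exists [::]; split; rewrite // U0 ?basisEfree ?nil_free ?span_nil ?subvv ?dimv0.
exists X; split=> // [|x Xx]; first exact: size_tuple.
rewrite /low lX // andbT.
exact: free_not0 (basis_free bX) Xx.
Qed.

(** Weights are invariant under scaling, so a line with one low generator has only
    low nonzero vectors. *)
Lemma line_low d (z : hwd F n d) u : \dim z = 1%N -> u \in hwd_space z ->
  u != 0 -> low d u /\ hwd_space z = <[u]>%VS.
Proof.
move=> dz zu u0; split; last first.
  by apply/esym/eqP; rewrite eqEdim -memvE zu dz dim_vline u0.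
have [X [bX]] := hwd_basis z; rewrite dz.
case: X bX => [|x [|y X]] //= bX _ lX.
have : u \in <[x]>%VS by rewrite -span_seq1 (span_basis bX).
case/vlineP=> a ua; have /andP[_ wx] := lX x (mem_head _ _).
have a0 : a != 0 by apply: contraNneq u0 => a0; rewrite ua a0 scale0r.
by rewrite /low u0 ua supp_scale.
Qed.

(** The low vectors of [U] are partitioned into the nonzero parts of its low
    lines, each of size [q - 1]. *)
Lemma card_low d U :
  #|[set u in U | low d u]| = (#|F|.-1 * #|lines d U|)%N.
Proof.
pose p u := insubd (hwd0 F n d) <[u]>%VS.
have pE u : low d u -> hwd_space (p u) = <[u]>%VS.
  by case/low_line_mem=> z zE; rewrite /p -zE valKd.
rewrite -sum1_card (partition_big p (mem (lines d U))) => [|u]; last first.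
  rewrite !inE => /andP[Uu lu]; rewrite pE // dim_vline -memvE Uu.
  by case/andP: lu => ->.
rewrite mulnC -sum_nat_const; apply: eq_bigr => z.
rewrite !inE => /andP[/eqP dz zU].
have := card_nz z; rewrite dz expn1 => <-; rewrite -sum1_card.
apply: eq_bigl => u; rewrite !inE; apply/idP/idP.
  case/andP=> /andP[Uu lu] /eqP <-; rewrite pE // memv_line.
  by case/andP: lu.
case/andP=> zu u0; have [lu zE] := line_low dz zu u0.
by rewrite lu (subvP zU) //=; apply/eqP/val_inj; rewrite /= pE.
Qed.

Lemma line_pick d U (z : hwd F n d) : z \in lines d U ->
  [/\ vpick z \in U, low d (vpick z) & hwd_space z = <[vpick z]>%VS].
Proof.
rewrite inE => /andP[/eqP dz zU].
have z0 : vpick z != 0 by rewrite vpick0 -dimv_eq0 dz.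
have [lz zE] := line_low dz (memv_pick _) z0.
by split=> //; apply: (subvP zU); apply: memv_pick.
Qed.

Lemma line_pick_indep d U (z1 z2 : hwd F n d) :
  z1 \in lines d U -> z2 \in lines d U -> z1 != z2 ->
  indep (vpick z1) (vpick z2).
Proof.
move=> l1 l2 ne12; have [_ /andP[nz1 _] e1] := line_pick l1.
have [_ _ e2] := line_pick l2.
rewrite /indep nz1; apply: contra ne12; rewrite -e1 => h.
move: l1 l2; rewrite !inE => /andP[/eqP d1 _] /andP[/eqP d2 _].
by apply/eqP/esym/val_inj/eqP => /=; rewrite eqEdim d1 d2 leqnn andbT e2 -memvE.
Qed.

Lemma two_lines d U u v : u \in U -> v \in U -> low d u -> low d v ->
  indep u v -> (1 < #|lines d U|)%N.
Proof.
move=> Uu Uv lu lv iuv; have [[x xE] [y yE]] := (low_line_mem lu, low_line_mem lv).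
apply/card_gt1P; exists x, y; rewrite !inE xE yE !dim_vline -!memvE Uu Uv.
case/andP: lu lv iuv => -> _ /andP[-> _] /andP[_ nv]; split=> //.
by apply: contraNneq nv => exy; rewrite -xE exy yE memv_line.
Qed.

(** A plane has a low-weight basis as soon as it contains two distinct low lines;
    this identifies the planes on which the truncated [a - 1] is nonzero. *)
Lemma plane_hwd d U : \dim U = 2 ->
  ((U == 0%VS) || has_low_weight_basis d U) = (1 < #|lines d U|)%N.
Proof.
move=> dU; apply/idP/idP => [hU | /card_gt1P[x [y [lx ly nexy]]]].
  have [X [/= bX]] := hwd_basis (HWD hU); rewrite /= dU.
  case: X bX => [|u [|v [|w X]]] //= bX _ lX.
  have UX x : x \in [:: u; v] -> x \in U by apply: basis_mem.
  by apply: (@two_lines d U v u); rewrite ?lX ?UX ?inE ?eqxx ?orbT // indep_free (basis_free bX).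
have iuv := line_pick_indep lx ly nexy.
have [[Uu lu _] [Uv lv _]] := (line_pick lx, line_pick ly).
apply/orP; right; apply/existsP; rewrite dU; exists [tuple vpick y; vpick x].
rewrite /= /hamming_weight; move: lu lv => /andP[_ ->] /andP[_ ->]; rewrite !andbT.
by rewrite basisEfree -indep_free iuv span_cons span_seq1 subv_add -!memvE Uu Uv dU.
Qed.

(** * The second Whitney number as a sum over all planes *)

Lemma hwd_ltE d (z U : hwd F n d) :
  (z < U)%O = (z <= U)%VS && (\dim z < \dim U)%N.
Proof.
rewrite lt_def [(z <= U)%O]/(_ <= _)%VS andbC; apply: andb_id2l => zU.
by rewrite ltn_neqAle (dimvS zU) andbT (dimv_leqif_eq zU) -val_eqE /= eq_sym.
Qed.

Lemma hwd0_le d (z : hwd F n d) : (hwd0 F n d <= z)%O.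
Proof. exact: sub0v. Qed.

Lemma hwd_dim0 d (z : hwd F n d) : (\dim z == 0)%N = (z == hwd0 F n d).
Proof. by rewrite -val_eqE /= -dimv_eq0. Qed.

Lemma hwd0_lt d (z : hwd F n d) : (hwd0 F n d < z)%O = (0 < \dim z)%N.
Proof. by rewrite hwd_ltE sub0v dimv0. Qed.

Lemma mobius_line d (z : hwd F n d) : \dim z = 1%N -> mobius (hwd0 F n d) z = -1.
Proof.
move=> dz; rewrite mobiusE hwd0_lt eq_sym -hwd_dim0 dz /=; congr (- _).
rewrite (big_pred1 (hwd0 F n d)) => [|t]; first by rewrite mobiusE eqxx.
rewrite hwd0_le /= hwd_ltE dz ltnS leqn0 hwd_dim0.
by case: eqP => [->|_]; rewrite ?sub0v ?andbF.
Qed.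

(** Below a plane there are only the zero space, of value [1], and the lines, of
    value [-1]; the values over the whole interval add up to zero. *)
Lemma mobius_plane d (U : hwd F n d) : \dim U = 2 ->
  mobius (hwd0 F n d) U = #|lines d U|%:Z - 1.
Proof.
move=> dU; rewrite mobiusE hwd0_lt eq_sym -hwd_dim0 dU /=.
rewrite (bigD1 (hwd0 F n d)) /=; last by rewrite hwd0_le hwd0_lt dU.
rewrite mobiusE eqxx (eq_bigl (mem (lines d U))) => [|z]; last first.
  rewrite !inE hwd0_le hwd_ltE dU -hwd_dim0 andbC /=.
  by case: (\dim z) => [|[|k]]; rewrite ?andbF ?andbT.
rewrite (eq_bigr (fun=> -1)) => [|z]; last first.
  by rewrite !inE => /andP[/eqP dz _]; apply: mobius_line.
by rewrite sumr_const mulNrn natz opprD opprK addrC.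
Qed.

(** The truncated predecessor discards the planes outside the lattice, so the sum
    may run over all of them. *)
Lemma whitney1_planes d :
  whitney1 F n d 2 =
  \sum_(U : {vspace 'rV[F]_n} | \dim U == 2) (#|lines d U|.-1)%:Z.
Proof.
rewrite /whitney1 [RHS](bigID (fun U => (U == 0%VS) || has_low_weight_basis d U)) /=.
rewrite [X in _ + X]big1 ?addr0 => [|U /andP[/eqP dU]]; last first.
  by rewrite plane_hwd // -leqNgt; case: #|_| => [|[]].
rewrite (reindex_omap (@hwd_space F n d) insub) => [|U /andP[_ hU]]; last first.
  by rewrite insubT.
apply: eq_big => [U | U /eqP dU]; first by rewrite valK eqxx andbT (valP U) andbT.
rewrite mobius_plane //; have := valP U; rewrite /= (plane_hwd d dU).
by case: #|_| => [|k] _ //=; rewrite -addn1 PoszD addrK.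
Qed.

(** * The number of low-weight lines in a plane *)

Lemma card_low_off_line d U u : u \in U -> low d u ->
  #|[set v in U | low d v && (v \notin <[u]>%VS)]| =
  (#|F|.-1 * #|lines d U|.-1)%N.
Proof.
move=> Uu lu; have u0 : u != 0 by case/andP: lu.
rewrite -[#|lines d U|.-1]subn1 mulnBr muln1 -card_low.
rewrite -(cardsID [set v in <[u]>%VS] [set v in U | low d v]).
have -> : #|F|.-1 = #|[set v in U | low d v] :&: [set v in <[u]>%VS]|.
  have := card_nz <[u]>%VS; rewrite dim_vline u0 expn1 => <-.
  apply: eq_card => v; rewrite !inE; apply/andP/andP => [[uv v0] | [] //]; last first.
    by case/andP=> _ /andP[].
  case/vlineP: uv v0 => a ->; rewrite scaler_eq0 (negPf u0) orbF => a0.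
  by rewrite !memvZ ?memv_line // /low scaler_eq0 negb_or a0 supp_scale.
by rewrite addKn; apply: eq_card => v; rewrite !inE andbA andbC.
Qed.

(** A linear functional on a plane has a nonzero kernel. *)
Lemma plane_vanishing U i : \dim U = 2 ->
  exists w, [/\ w \in U, w != 0 & w 0 i = 0].
Proof.
move=> dU; pose u := vpick U.
have u0 : u != 0 by rewrite vpick0 -dimv_eq0 dU.
have [v Uv nuv] : exists2 v, v \in U & v \notin <[u]>%VS.
  by apply/subvPn/negP => /dimvS; rewrite dU dim_vline u0.
have [ui | nui] := eqVneq (u 0 i) 0; first by exists u; rewrite memv_pick.
exists (v - (v 0 i / u 0 i) *: u); split.
- by rewrite memvB // memvZ // memv_pick.
- by apply: contra nuv; rewrite subr_eq0 => /eqP->; rewrite memvZ // memv_line.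
by rewrite !mxE divfK ?subrr.
Qed.

(** A nonzero vector of [U] vanishing at a coordinate of the support of [U] has
    weight at most [d].  One such vector [w1] is itself nonzero at some
    coordinate [j] of the support, and a second one vanishing at [j] is then
    independent of it. *)
Lemma small_plane_lines d U : \dim U = 2 -> (#|vsupp U| <= d.+1)%N ->
  (1 < #|lines d U|)%N.
Proof.
move=> dU leU.
have van i w : i \in vsupp U -> w \in U -> w != 0 -> w 0 i = 0 -> low d w.
  move=> Ui Uw w0 wi; rewrite /low w0 /= -ltnS (leq_trans _ leU) //.
  apply: proper_card; apply/properP; split; first exact: vsupp_sub.
  by exists i; rewrite // inE wi eqxx.
have nzP w : w != 0 -> exists i, w 0 i != 0.
  by move=> w0; apply/existsP; apply: contraNT w0 => /existsPn w0;
     apply/eqP/rowP => i; rewrite mxE; apply/eqP/negbNE/w0.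
have suppU i w : w \in U -> w 0 i != 0 -> i \in vsupp U.
  by move=> Uw wi; apply: (subsetP (vsupp_sub Uw)); rewrite inE.
have u0 : vpick U != 0 by rewrite vpick0 -dimv_eq0 dU.
have [i ui] := nzP _ u0; have Ui := suppU _ _ (memv_pick _) ui.
have [w1 [U1 n1 z1]] := plane_vanishing i dU.
have [j w1j] := nzP _ n1; have Uj := suppU _ _ U1 w1j.
have [w2 [U2 n2 z2]] := plane_vanishing j dU.
apply: (two_lines U2 U1 (van j w2 _ _ _ _) (van i w1 _ _ _ _)) => //.
rewrite /indep n2; apply: contra w1j => /vlineP[a ->].
by rewrite mxE z2 mulr0.
Qed.

(** The supports of three pairwise independent vectors of [U] cover each coordinate
    of the support of [U] at least twice, so that twice its size is at most the sum
    of the three weights. *)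
Lemma large_plane_lines d U : \dim U = 2 -> (3 * d < 2 * #|vsupp U|)%N ->
  (#|lines d U| <= 2)%N.
Proof.
move=> dU gtU; rewrite leqNgt; apply: contraL gtU.
case/card_gt2P=> x [y [z [[lx ly lz] [nxy nyz nzx]]]]; rewrite -leqNgt.
have [[Ux wx _] [Uy wy _] [Uz wz _]] := And3 (line_pick lx) (line_pick ly) (line_pick lz).
have sxy := vsupp_basis dU Ux Uy (line_pick_indep lx ly nxy).
have syz := vsupp_basis dU Uy Uz (line_pick_indep ly lz nyz).
have szx := vsupp_basis dU Uz Ux (line_pick_indep lz lx nzx).
set A := supp (vpick x) in sxy szx; set B := supp (vpick y) in sxy syz.
set C := supp (vpick z) in syz szx.
(* A coordinate missing from [C] lies in both [A] and [B]. *)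
have sub : vsupp U \subset (A :&: B) :|: C.
  apply/subsetP => i Ui; rewrite in_setU in_setI.
  move: (Ui) (Ui); rewrite -{1}syz -szx !in_setU.
  by case: (i \in C); case: (i \in A); case: (i \in B).
have := leq_trans (subset_leq_card sub) (leq_card_setU _ _).
have := cardsUI A B; rewrite sxy.
by move: wx wy wz => /andP[_ +] /andP[_ +] /andP[_ +]; rewrite -/A -/B -/C; lia.
Qed.

(** * Charging the Möbius values to ordered bases *)

(** The charge of an ordered basis [(u, v)] of a plane, in terms of [i], the
    weight of [u], [j], the number of coordinates where both vectors are nonzero,
    and [k], the number of those where only [v] is; so [i + k] is the size [s] of
    the support of the plane and [j + k] the weight of [v].  Write [a] for the
    number of lines of low-weight vectors in the plane and [e] for its number of
    ordered bases.  The charges of these bases have to add up to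
    [2 * e * (a - 1)], or to [0] if [a = 0].
    - If [s <= 3] then [a = q + 1], and a constant charge [2 * q] does it.
    - If [s = 4] then [a >= 2], and [e * a / (q + 1)] bases have a low-weight
      first vector.
    - If [s >= 5] then [a <= 2], so that [2 * (a - 1)] is [a * (a - 1)] as soon as
      [a > 0], and [(q - 1) ^ 2 * a * (a - 1)] bases, that is
      [e * a * (a - 1) / (q * (q + 1))], consist of two low-weight vectors. *)
Definition charge_card (q : rat) (i j k : nat) : rat :=
  if (i + k <= 3)%N then 2 * q
  else if (i + k == 4)%N then 2 * (q + 1) * (i <= 3)%N%:R - 2
  else q * (q + 1) * ((i <= 3) && (j + k <= 3))%N%:R.

Definition charge u v : rat :=
  charge_card #|F|%:R #|supp u| #|supp u :&: supp v| #|supp v :\: supp u|.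

Lemma chargeE u v : charge u v =
  if (#|supp u :|: supp v| <= 3)%N then 2 * #|F|%:R
  else if #|supp u :|: supp v| == 4 then
    2 * (#|F|%:R + 1) * (#|supp u| <= 3)%N%:R - 2
  else #|F|%:R * (#|F|%:R + 1) * ((#|supp u| <= 3) && (#|supp v| <= 3))%N%:R.
Proof.
rewrite /charge /charge_card.
have -> : (#|supp u| + #|supp v :\: supp u| = #|supp u :|: supp v|)%N.
  by rewrite -(cardsID (supp u) (supp u :|: supp v)) setUK setDUl setDv set0U.
by rewrite setIC cardsID.
Qed.

(** The property that the charge is made for: in each of the three ranges of the
    size of the support, the sum counts suitable bases of [U], through the number
    of low vectors in [U], [(q - 1) * a]. *)
Lemma sum_charge_plane U : \dim U = 2 ->
  \sum_(u in U | u != 0) \sum_(v in U | v \notin <[u]>%VS) charge u v =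
  2 * (#|F|%:R ^+ 2 - 1) * (#|F|%:R ^+ 2 - #|F|%:R) * (#|lines 3 U|.-1)%:R.
Proof.
move=> dU; set q := #|F|; set a := #|lines 3 U|.
have q_gt1 : (1 < q)%N := card_finNzRing_gt1 F.
have q0 : q%:R - 1 != 0 :> rat by rewrite subr_eq0 pnatr_eq1 gtn_eqF.
have cu : #|[set u in U | u != 0]|%:R = q%:R ^+ 2 - 1 :> rat.
  by rewrite card_nz dU -/q -subn1 natrB ?natrX // expn_gt0 ltnW.
have cv u : u \in U -> u != 0 ->
    #|[set v in U | v \notin <[u]>%VS]|%:R = q%:R ^+ 2 - q%:R :> rat.
  by move=> Uu u0; rewrite card_off_line // dU -/q natrB ?natrX // -{1}[q]expn1 leq_exp2l.
have cl : #|[set u in U | low 3 u]|%:R = (q%:R - 1) * a%:R :> rat.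
  by rewrite card_low natrM -subn1 natrB // ltnW.
have sU u v : u \in U -> u != 0 -> v \in U -> v \notin <[u]>%VS ->
    supp u :|: supp v = vsupp U.
  by move=> Uu u0 Uv nuv; apply: vsupp_basis; rewrite // /indep u0.
have pred_a : (1 < a)%N -> (a.-1)%:R = a%:R - 1 :> rat.
  by move=> a_gt1; rewrite -subn1 natrB // ltnW.
have lowE u : u \in U -> u != 0 -> (#|supp u| <= 3)%N = low 3 u.
  by move=> _ u0; rewrite /low u0.
have nz_low : [set u | (u \in U) && (u != 0) && low 3 u] = [set u in U | low 3 u].
  by apply/setP => u; rewrite !inE /low -andbA; case: (u != 0); rewrite ?andbF.
(* Support of size at most 3: all nonzero vectors of [U] are low. *)
have [leU3 | gtU3] := leqP #|vsupp U| 3.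
  have a_gt1 : (1 < a)%N by apply: small_plane_lines; rewrite // ltnW.
  have aE : a%:R = q%:R + 1 :> rat.
    apply: (mulfI q0); rewrite -cl; transitivity (q%:R ^+ 2 - 1 : rat); last by ring.
    rewrite -cu; congr _%:R; apply: eq_card => u; rewrite !inE /low.
    apply: andb_id2l => Uu; rewrite (leq_trans (subset_leq_card (vsupp_sub Uu))) //.
    by rewrite andbT.
  transitivity (\sum_(u in U | u != 0) 2 * q%:R * (q%:R ^+ 2 - q%:R) : rat).
    apply: eq_bigr => u /andP[Uu u0]; rewrite -(cv u) // -sum_const_pred.
    by apply: eq_bigr => v /andP[Uv nuv]; rewrite chargeE (sU u v) ?leU3.
  by rewrite sum_const_pred cu pred_a // aE; ring.
(* Support of size 4: the sum counts the bases with a low first vector. *)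
have [eqU4 | neU4] := eqVneq #|vsupp U| 4.
  have a_gt1 : (1 < a)%N by apply: small_plane_lines; rewrite // eqU4.
  transitivity (\sum_(u in U | u != 0)
      (2 * (q%:R + 1) * (low 3 u)%:R - 2) * (q%:R ^+ 2 - q%:R) : rat).
    apply: eq_bigr => u /andP[Uu u0]; rewrite -(cv u) // -sum_const_pred.
    apply: eq_bigr => v /andP[Uv nuv].
    by rewrite chargeE (sU u v) // leqNgt gtU3 eqU4 /= (lowE u).
  rewrite -mulr_suml sumrB -mulr_sumr sum_const_pred sum_bool_pred cu.
  by rewrite nz_low cl pred_a //; ring.
(* Larger support: the sum counts the bases made of two low vectors. *)
transitivity (\sum_(u in U | u != 0)
    q%:R * (q%:R + 1) * ((q%:R - 1) * (a.-1)%:R) * (low 3 u)%:R : rat).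
  apply: eq_bigr => u /andP[Uu u0].
  transitivity (\sum_(v in U | v \notin <[u]>%VS)
     q%:R * (q%:R + 1) * (low 3 u)%:R * (low 3 v)%:R : rat).
    apply: eq_bigr => v /andP[Uv nuv].
    have v0 : v != 0 by apply: contraNneq nuv => ->; rewrite mem0v.
    rewrite chargeE (sU u v) // leqNgt gtU3 (negPf neU4) /= !lowE //.
    by rewrite -[RHS]mulrA -natrM mulnb.
  rewrite -mulr_sumr sum_bool_pred.
  have [lu | _] := boolP (low 3 u); last by rewrite !mulr0 mul0r.
  have -> : [set v | (v \in U) && (v \notin <[u]>%VS) && low 3 v] =
      [set v in U | low 3 v && (v \notin <[u]>%VS)].
    by apply/setP => v; rewrite !inE -andbA; congr (_ && _); rewrite andbC.
  rewrite card_low_off_line // -/q -/a natrM -subn1 natrB ?(ltnW q_gt1) //.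
  by rewrite !mulr1.
rewrite -mulr_sumr sum_bool_pred.
rewrite nz_low cl; have : (a <= 2)%N by apply: large_plane_lines; lia.
by case: (a) => [|[|[|//]]] _ /=; ring.
Qed.

(** Each independent pair spans exactly one plane. *)
Lemma sum_planes (R : nmodType) (f : 'rV[F]_n -> 'rV[F]_n -> R) :
  \sum_(U : {vspace 'rV[F]_n} | \dim U == 2)
    \sum_(u in U | u != 0) \sum_(v in U | v \notin <[u]>%VS) f u v =
  \sum_(u : 'rV[F]_n | u != 0) \sum_(v : 'rV[F]_n | v \notin <[u]>%VS) f u v.
Proof.
rewrite (exchange_big_dep (fun u : 'rV[F]_n => u != 0)) => [|U u _ /andP[]] //=.
apply: eq_bigr => u u0.
rewrite (exchange_big_dep (fun v : 'rV[F]_n => v \notin <[u]>%VS)) => [|U v _ /andP[]] //=.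
apply: eq_bigr => v nuv.
have iuv : indep u v by rewrite /indep u0.
rewrite (big_pred1 (<[u]> + <[v]>)%VS) // => U; rewrite u0 nuv !andbT /=.
apply/idP/eqP => [/andP[/andP[/eqP dU Uu] Uv] | ->]; first exact: plane_spanned.
rewrite !memvE addvSl addvSr !andbT.
by move: iuv; rewrite indep_sym indep_free -(span_seq1 v) -span_cons => /eqP ->.
Qed.

(** For [v] in the line of [u] the charge depends on the weight of [u] alone.  At
    weight 4 the [q] multiples of [u], each of charge [-2], are compensated by the
    pair [(0, u)], of charge [2 * q]; at larger weights the charges are zero. *)
Lemma sum_charge_dependent :
  \sum_v charge 0 v + \sum_(u : 'rV[F]_n | u != 0) \sum_(v in <[u]>%VS) charge u v =
  2 * #|F|%:R * (#|F|%:R + 1) *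
    (\sum_(k < 4) (#|F|%:R - 1) ^+ k * 'C(n, k)%:R) - 2 * #|F|%:R ^+ 2.
Proof.
set q : rat := #|F|%:R.
pose ind k v : rat := (#|supp v| <= k)%N%:R.
have w0 v : charge 0 v = 2 * q * ind 4 v.
  rewrite chargeE supp0 set0U cards0 /= -/q /ind.
  by case: #|supp v| => [|[|[|[|[|k]]]]] /=; ring.
have w1 u v : v \in <[u]>%VS -> charge u v = 2 * (q + 1) * ind 3 u - 2 * ind 4 u.
  case/vlineP=> b ->; have sub := supp_scale_sub b u.
  rewrite chargeE (setUidPl sub) -/q /ind.
  case: #|supp u| => [|[|[|[|[|k]]]]] /=; ring.
have line u : u != 0 -> \sum_(v in <[u]>%VS) charge u v =
    (2 * (q + 1) * ind 3 u - 2 * ind 4 u) * q.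
  move=> u0; have cu : #|<[u]>%VS| = #|F| by rewrite card_vspace dim_vline u0 expn1.
  by rewrite (eq_bigr _ (w1 u)) sumr_const -[LHS]mulr_natr cu.
under eq_bigr do rewrite w0.
rewrite (eq_bigr _ line).
pose h u := (2 * (q + 1) * ind 3 u - 2 * ind 4 u) * q.
(* Allowing [u = 0] adds the term [h 0 = 2 * q ^+ 2]. *)
have -> : \sum_(u : 'rV[F]_n | u != 0) h u = \sum_u h u - 2 * q ^+ 2.
  by rewrite [in RHS](bigD1 0) //= /h /ind supp0 cards0 /=; ring.
rewrite addrA -big_split /=; congr (_ - _).
transitivity (\sum_u 2 * q * (q + 1) * ind 3 u).
  by apply: eq_bigr => u _; rewrite /h; ring.
rewrite -mulr_sumr; congr (_ * _).
rewrite (@sum_by_supp _ (fun A => (#|A| <= 3)%N%:R)).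
pose f k : rat := (k <= 3)%N%:R * (q - 1) ^+ k.
transitivity (\sum_(A : {set 'I_n} | A \subset [set: 'I_n]) f #|A|).
  apply: eq_big => [A | A _]; first by rewrite subsetT.
  by rewrite -[LHS]mulr_natr natrX -subn1 natrB // ltnW // card_finNzRing_gt1.
rewrite (@sum_subsets_by_card _ _ _ 4) => [|k /andP[lt3k _]]; last first.
  by rewrite /f leqNgt lt3k mul0r.
rewrite cardsT card_ord; apply: eq_bigr => k _.
by rewrite /f -ltnS ltn_ord mul1r mulr_natr.
Qed.

(** The ranges of [i] and [k] can be cut at 5: a nonzero charge needs a union of
    supports of size at most 4, or two supports of size at most 3. *)
Lemma sum_charge :
  \sum_u \sum_v charge u v =
  \sum_(i < 5) \sum_(j < i.+1) \sum_(k < 5)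
    charge_card #|F|%:R i j k * (#|F|%:R - 1) ^+ (i + j + k)
      *+ ('C(n, i) * 'C(i, j) * 'C(n - i, k)).
Proof.
set q : rat := #|F|%:R.
have qE k : (#|F|.-1 ^ k)%:R = (q - 1) ^+ k.
  by rewrite natrX -subn1 natrB // ltnW // card_finNzRing_gt1.
pose g i j k := charge_card q i j k * (q - 1) ^+ (i + j + k).
have g0 i j k : (j <= i)%N -> (5 <= i)%N || (5 <= k)%N -> g i j k = 0.
  move=> leji lt4; rewrite /g /charge_card.
  have gt4 : (4 < i + k)%N by case/orP: lt4; lia.
  have -> : (i + k <= 3)%N = false by lia.
  have -> : (i + k == 4)%N = false by lia.
  have -> : (i <= 3)%N && (j + k <= 3)%N = false by lia.
  by rewrite mulr0 mul0r.
have := @sum_pairs_by_card rat 'I_n 5 g g0; rewrite card_ord => <-.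
rewrite (@sum_by_supp _ (fun A => \sum_v
  charge_card q #|A| #|A :&: supp v| #|supp v :\: A|)).
apply: eq_bigr => A _.
rewrite (@sum_by_supp _ (fun B => charge_card q #|A| #|A :&: B| #|B :\: A|)).
rewrite -sumrMnl; apply: eq_bigr => B _.
rewrite -mulrnA -[LHS]mulr_natr natrM !qE -exprD /g -addnA [(#|B| + _)%N]addnC.
by rewrite -(cardsID A B) [B :&: A]setIC.
Qed.

(** Summing over the independent pairs amounts to summing over all pairs and
    removing those with [u = 0] and those with [v] in the line of [u]. *)
Lemma whitney1_2_charge :
  2 * (#|F|%:R ^+ 2 - 1) * (#|F|%:R ^+ 2 - #|F|%:R) * (whitney1 F n 3 2)%:~R =
  \sum_u \sum_v charge u v
  - (\sum_v charge 0 v + \sum_(u : 'rV[F]_n | u != 0) \sum_(v in <[u]>%VS) charge u v).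
Proof.
rewrite whitney1_planes rmorph_sum mulr_sumr /=.
rewrite (eq_bigr (fun U : {vspace 'rV[F]_n} =>
  \sum_(u in U | u != 0) \sum_(v in U | v \notin <[u]>%VS) charge u v)); last first.
  by move=> U /eqP dU; rewrite sum_charge_plane.
rewrite sum_planes [\sum_u \sum_v _](bigD1 0) //= opprD addrACA subrr add0r -sumrB.
by apply: eq_bigr => u u0; rewrite [X in X - _](bigID (mem <[u]>%VS)) /= addrC addrK.
Qed.

End Dowling.

(** * The polynomial formula *)

Theorem theorem7p6 (q n : nat)
    (hq : exists p k : nat, [/\ prime p, (0 < k)%N & q = (p ^ k)%N])
    (hn : (6 <= n)%N) (F : finFieldType) (hF : #|F| = q) :
  let x : rat := q%:R in
  let y : rat := n%:R in
  (whitney1 F n 3 2)%:~R =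
    (1 / 72) * x ^+ 4 * y ^+ 6
    - (1 / 12) * x ^+ 4 * y ^+ 5
    + (1 / 18) * x ^+ 4 * y ^+ 4
    + (1 / 2) * x ^+ 4 * y ^+ 3
    - (77 / 72) * x ^+ 4 * y ^+ 2
    + (7 / 12) * x ^+ 4 * y
    - (1 / 18) * x ^+ 3 * y ^+ 6
    + (5 / 12) * x ^+ 3 * y ^+ 5
    - (49 / 72) * x ^+ 3 * y ^+ 4
    - (7 / 6) * x ^+ 3 * y ^+ 3
    + (269 / 72) * x ^+ 3 * y ^+ 2
    - (9 / 4) * x ^+ 3 * y
    + (1 / 12) * x ^+ 2 * y ^+ 6
    - (3 / 4) * x ^+ 2 * y ^+ 5
    + 2 * x ^+ 2 * y ^+ 4
    - (7 / 12) * x ^+ 2 * y ^+ 3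
    - (43 / 12) * x ^+ 2 * y ^+ 2
    + (17 / 6) * x ^+ 2 * y
    - (1 / 18) * x * y ^+ 6
    + (7 / 12) * x * y ^+ 5
    - (157 / 72) * x * y ^+ 4
    + (19 / 6) * x * y ^+ 3
    - (55 / 72) * x * y ^+ 2
    - (3 / 4) * x * y
    + (1 / 72) * y ^+ 6
    - (1 / 6) * y ^+ 5
    + (29 / 36) * y ^+ 4
    - (23 / 12) * y ^+ 3
    + (157 / 72) * y ^+ 2
    - (11 / 12) * y.
Proof.
move=> x y.
have x_gt1 : 1 < x by rewrite /x -hF ltr1n card_finNzRing_gt1.
have nz : 2 * (x ^+ 2 - 1) * (x ^+ 2 - x) != 0.
  apply: lt0r_neq0.
  have -> : 2 * (x ^+ 2 - 1) * (x ^+ 2 - x) = 2 * (x - 1) ^+ 2 * ((x + 1) * x) by ring.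
  have x1_gt0 : 0 < x - 1 by rewrite subr_gt0.
  have x_gt0 : 0 < x := lt_trans ltr01 x_gt1.
  by apply: mulr_gt0; apply: mulr_gt0; rewrite ?exprn_gt0 ?x1_gt0 //; lra.
have := whitney1_2_charge F n.
rewrite sum_charge sum_charge_dependent hF -/x => wE; apply: (mulfI nz).
rewrite wE {wE nz}.
(* Only [i <= 4] occurs, and [n >= 6], so the subtraction in [n - i] is exact. *)
have subE (i : 'I_5) : (n - i)%:R = y - i%:R.
  by rewrite natrB // ltnW // (leq_trans (ltn_ord i)) // ltnW.
under eq_bigr => i _ do under eq_bigr => j _ do under eq_bigr => k _ do
  rewrite -[_ *+ _]mulr_natr !natrM (natr_bin n i) (natr_bin (n - i) k) subE -/y.
under [in X in _ - X]eq_bigr => k _ do rewrite (natr_bin n k) -/y.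
rewrite !big_ord_recr !big_ord0 /= /charge_card /=.
rewrite !(binS, bin0, bin0n, binn) !factS fact0.
rewrite /falling !big_ord_recr !big_ord0 /=.
by field.
Qed.
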